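(* Let $k, k', l$ be integers with $0 \le k < k' \le l$. Then for every integer $g$ with $0 \le g \le l-k'$, the games $W_{k,l}$ and $W_{k',l}$ have exactly the same set of positions with nim-value $g$.
   Context: Positions are pairs $(a,b)$ of nonnegative integers. For integers $0 \le k \le l$, the impartial game $W_{k,l}$ (normal play: the last player able to move wins) allows from $(a,b)$ the following moves: a Nim move to $(a-s,b)$ or $(a,b-s)$ for any integer $s>0$ keeping coordinates nonnegative; and a diagonal move to $(a-s,b-s)$ with $s>0$, allowed only if $\min(a-s,b-s) \ge k$ and $\max(a-s,b-s) \ge l$. The nim-value (Sprague–Grundy value) of a position is defined recursively: it is the minimum excluded nonnegative integer (mex) of the set of nim-values of positions reachable in one move (so terminal positions have nim-value $0$). A $g$-position is a position with nim-value $g$. *)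

(* Defs.v *)
From mathcomp Require Import all_boot.
From mathcomp Require Import zify.

Set Implicit Arguments.
Unset Strict Implicit.
Unset Printing Implicit Defensive.

Definition position : Type := (nat * nat)%type.

Definition W_options (k l : nat) (p : position) : seq position :=
  [seq (p.1 - s, p.2) | s <- iota 1 p.1] ++
  [seq (p.1, p.2 - s) | s <- iota 1 p.2] ++
  [seq (p.1 - s, p.2 - s) | s <- iota 1 (minn p.1 p.2) &
     (k <= minn (p.1 - s) (p.2 - s)) && (l <= maxn (p.1 - s) (p.2 - s))].

Lemma W_optionsP (k l a b : nat) (q : position) :
  q \in W_options k l (a, b) <->
  exists2 s, 0 < s &
    [\/ s <= a /\ q = (a - s, b),
        s <= b /\ q = (a, b - s)
      | [/\ s <= a, s <= b, k <= minn (a - s) (b - s),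
            l <= maxn (a - s) (b - s) & q = (a - s, b - s)]].
Proof.
rewrite /W_options !mem_cat /=; split.
  case/or3P => /mapP [s].
  - by rewrite mem_iota => hs ->; exists s; [lia | constructor 1; split; [lia|]].
  - by rewrite mem_iota => hs ->; exists s; [lia | constructor 2; split; [lia|]].
  - rewrite mem_filter mem_iota => /andP [/andP [hk hl] hs] ->.
    by exists s; [lia | constructor 3; split => //; lia].
move=> [s s0 [[sa ->]|[sb ->]|[sa sb hk hl ->]]]; apply/or3P.
- by constructor 1; apply/mapP; exists s; rewrite // mem_iota; lia.
- by constructor 2; apply/mapP; exists s; rewrite // mem_iota; lia.
- constructor 3; apply/mapP; exists s => //.
  by rewrite mem_filter hk hl mem_iota; lia.
Qed.

Lemma ex_notin (s : seq nat) : exists n, n \notin s.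
Proof.
exists (\max_(i <- s) i).+1; apply/negP => h.
by have := @leq_bigmax_seq _ s xpredT id _ h isT; rewrite ltnn.
Qed.

Definition mex (s : seq nat) : nat := ex_minn (ex_notin s).

Lemma W_options_lt (k l : nat) (p q : position) :
  q \in W_options k l p -> q.1 + q.2 < p.1 + p.2.
Proof.
by case: p => a b /W_optionsP [s s0 [[? ->]|[? ->]|[? ? ? ? ->]]] /=; lia.
Qed.

(* Every move decreases the coordinate sum, so (p.1 + p.2).+1 rounds of
   recursion suffice; [nim_valueE] is the fuel-free defining equation. *)
Fixpoint nim_value_rec (k l n : nat) (p : position) : nat :=
  if n is m.+1 then mex [seq nim_value_rec k l m q | q <- W_options k l p]
  else 0.

Definition nim_value (k l : nat) (p : position) : nat :=
  nim_value_rec k l (p.1 + p.2).+1 p.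

Lemma nim_value_rec_enough (k l n : nat) (p : position) :
  p.1 + p.2 < n -> nim_value_rec k l n p = nim_value k l p.
Proof.
suff H m : p.1 + p.2 < n -> p.1 + p.2 < m ->
    nim_value_rec k l n p = nim_value_rec k l m p by move=> /H; exact.
elim: n m p => [//|n IH] [//|m] p lt_pn lt_pm /=.
congr mex; apply/eq_in_map => q /W_options_lt lt_qp.
by apply: IH; apply: leq_trans lt_qp _.
Qed.

Lemma nim_valueE (k l : nat) (p : position) :
  nim_value k l p = mex [seq nim_value k l q | q <- W_options k l p].
Proof.
rewrite {1}/nim_value /=; congr mex; apply/eq_in_map => q /W_options_lt.
exact: nim_value_rec_enough.
Qed.

(* Main.v *)
Require Import Defs.
From mathcomp Require Import all_boot.
From mathcomp Require Import zify.

(** The two games differ only in diagonal moves to positions with one coordinate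
    below [k'] and the other at least [l].  No diagonal move of [W_{k',l}] starts
    in that strip, so the game there is two-heap Nim, whose values are at least
    the difference of the coordinates, which exceeds [l - k'].  By induction on
    the position, the extra moves never reach a nim-value [g <= l - k'], so they
    do not influence whether [g] is the mex. *)

Lemma mex_notin (s : seq nat) : mex s \notin s.
Proof. by rewrite /mex; case: ex_minnP. Qed.

Lemma mem_lt_mex [s : seq nat] [h : nat] : h < mex s -> h \in s.
Proof.
rewrite /mex; case: ex_minnP => m _ m_min lt_hm.
by apply: contraLR lt_hm => /m_min; rewrite -leqNgt.
Qed.

Lemma mex_eqP (s : seq nat) (g : nat) :
  mex s = g <-> g \notin s /\ (forall h, h < g -> h \in s).
Proof.
split=> [<-|[g_notin lt_in]]; first by split; [exact: mex_notin | exact: mem_lt_mex].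
case: (ltngtP (mex s) g) => // [/lt_in | /mem_lt_mex].
  by rewrite (negbTE (mex_notin s)).
by rewrite (negbTE g_notin).
Qed.

(** Allows options of value above [g] to be ignored when the two games are compared. *)
Lemma eq_mex_below [s t : seq nat] [g : nat] :
  (forall h, h <= g -> (h \in s) = (h \in t)) -> mex s = g <-> mex t = g.
Proof.
move=> eq_st; rewrite !mex_eqP eq_st //.
split=> -[g_notin lt_in]; split=> // h lt_hg.
  by rewrite -eq_st ?lt_in // ltnW.
by rewrite eq_st ?lt_in // ltnW.
Qed.

Lemma nim_value_option_neq [k l : nat] [p q : position] :
  q \in W_options k l p -> nim_value k l q <> nim_value k l p.
Proof.
move=> q_opt eq_v; have := mex_notin [seq nim_value k l r | r <- W_options k l p].
by rewrite -nim_valueE -eq_v map_f.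
Qed.

Lemma nim_value_gt_option [k l : nat] [p : position] [h : nat] :
  h < nim_value k l p ->
  exists2 q, q \in W_options k l p & nim_value k l q = h.
Proof.
by rewrite nim_valueE => /mem_lt_mex /mapP [q q_opt ->]; exists q.
Qed.

Lemma W_options_swap [k l : nat] [p q : position] :
  q \in W_options k l p -> (q.2, q.1) \in W_options k l (p.2, p.1).
Proof.
case: p => a b /W_optionsP [s s0 H]; apply/W_optionsP; exists s => //.
case: H => [[sa ->]|[sb ->]|[sa sb hk hl ->]] /=.
- by constructor 2.
- by constructor 1.
- by constructor 3; split=> //; [rewrite minnC | rewrite maxnC].
Qed.

(** Needed because [nim_value_strip_ge] treats only a small first coordinate. *)
Lemma nim_value_swap (k l : nat) (p : position) :
  nim_value k l (p.2, p.1) = nim_value k l p.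
Proof.
have [n] := ubnP (p.1 + p.2); elim: n p => // n IH p lt_pn.
rewrite nim_valueE; apply/mex_eqP; split.
  (* Swapped back, such a [q] would by induction be an option of [p] with the value of [p]. *)
  apply/mapP => -[q q_opt eq_v].
  have q_opt' := W_options_swap q_opt; case: p => [a b] in lt_pn eq_v q_opt q_opt' *.
  apply: (nim_value_option_neq q_opt'); rewrite eq_v.
  by apply: IH; have := W_options_lt q_opt; rewrite /= in lt_pn *; lia.
move=> h /nim_value_gt_option [q q_opt <-]; apply/mapP.
exists (q.2, q.1); first exact: W_options_swap.
by rewrite IH //; have := W_options_lt q_opt; lia.
Qed.

(** A Nim move joins any two distinct positions of a row. *)
Lemma nim_value_row_inj [k l c d d' : nat] :
  nim_value k l (c, d) = nim_value k l (c, d') -> d = d'.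
Proof.
wlog lt_dd' : d d' / d < d' => [H eq_v|eq_v].
  by case: (ltngtP d d') => // lt; [exact: H | symmetry; apply: H].
case: (@nim_value_option_neq k l (c, d') (c, d)) => //; apply/W_optionsP.
exists (d' - d); first by lia.
by constructor 2; split; [lia | congr pair; lia].
Qed.

(* Pigeonhole: let [h] be the value of [(c, d)].  No [d' < d] has [(c, d')] of
   value [h]; at most [h] of them give a smaller value, and at most [c] a larger
   one, since each of the latter has a position [(c', d')] of value [h] with
   [c' < c] below it, and a row contains [h] at most once. *)
Lemma nim_value_strip_ge [k l c d : nat] :
  c <= k -> d - c <= nim_value k l (c, d).
Proof.
move=> le_ck; set v := nim_value k l; set h := v (c, d).
pose col d' := find (fun c' => v (c', d') == h) (iota 0 c).
have colP d' : d' < d -> ~~ (v (c, d') < h) ->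
    col d' < c /\ v (col d', d') = h.
  move=> lt_d'd; rewrite -leqNgt leq_eqVlt => /orP [/eqP /nim_value_row_inj|].
    by lia.
  case/nim_value_gt_option => q /W_optionsP [s s0 H] vq.
  have : has (fun c' => v (c', d') == h) (iota 0 c).
    case: H => [[sc Eq]|[sd Eq]|[sc sd hk hl _]].
    - apply/hasP; exists (c - s); first by rewrite mem_iota; lia.
      by rewrite -Eq; apply/eqP.
    - by move: vq; rewrite Eq => /nim_value_row_inj; lia.
    (* A diagonal move would end with first coordinate below [c <= k]. *)
    - by lia.
  move=> hasc; have lt_col : col d' < c by rewrite has_find size_iota in hasc.
  split=> //; have /eqP := nth_find 0 hasc.
  by rewrite nth_iota.
(* Injects [[0, d)] into [[0, h + c)]: small values land below [h], columns from [h] on; hence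
   [d <= h + c]. *)
pose f d' := if v (c, d') < h then v (c, d') else h + col d'.
have f_inj : {in iota 0 d &, injective f}.
  move=> x y; rewrite !mem_iota /= add0n => lt_x lt_y; rewrite /f.
  case: ifPn => [hx|/colP-/(_ lt_x) [cx vx]];
    case: ifPn => [hy|/colP-/(_ lt_y) [cy vy]] eq_f.
  - exact: nim_value_row_inj eq_f.
  - by lia.
  - by lia.
  - apply: (@nim_value_row_inj k l (col x)); rewrite -/v vx.
    by rewrite (addnI eq_f) vy.
have : size (map f (iota 0 d)) <= size (iota 0 (h + c)).
  apply: uniq_leq_size; first by rewrite map_inj_in_uniq ?iota_uniq.
  move=> y /mapP [x]; rewrite !mem_iota /= !add0n => lt_x ->.
  by rewrite /f; case: ifPn => [|/colP-/(_ lt_x) [cx _]]; lia.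
by rewrite size_map !size_iota; lia.
Qed.

Theorem theorem5 (k k' l : nat) (lt_kk' : k < k') (le_k'l : k' <= l)
    (g : nat) (le_g : g <= l - k') :
  forall p : position, nim_value k l p = g <-> nim_value k' l p = g.
Proof.
move=> p; have [n] := ubnP (p.1 + p.2).
elim: n p g le_g => // n IH p g le_g lt_pn.
rewrite !nim_valueE; apply: eq_mex_below => h le_hg.
have IHq q : q \in W_options k l p ->
    nim_value k l q = h <-> nim_value k' l q = h.
  by move=> /W_options_lt lt_qp; apply: IH; lia.
have opt_sub q : q \in W_options k' l p -> q \in W_options k l p.
  case: (p) => a b /W_optionsP [s s0 H]; apply/W_optionsP; exists s => //.
  case: H => [?|?|[? ? ? ? ?]]; [by constructor 1 | by constructor 2 |].
  by constructor 3; split=> //; lia.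
apply/mapP/mapP => -[q q_opt eq_h]; last first.
  by exists q; [exact: opt_sub | symmetry; apply/IHq; [exact: opt_sub|]].
(* The strip bound will be applied in the game with [k'], so the value is first transferred
   there. *)
have vq : nim_value k' l q = h by apply/IHq.
exists q => //; case: p q_opt {IHq opt_sub lt_pn} => a b /W_optionsP [s s0 H].
apply/W_optionsP; exists s => //.
case: H => [?|?|[sa sb hk hl Eq]]; [by constructor 1 | by constructor 2 |].
constructor 3; split=> //; rewrite leqNgt; apply/negP => lt_min.
(* One coordinate is below [k'] and the other at least [l], so they differ by more than [l - k'],
   which is at least [h]. *)
case: (leqP (a - s) (b - s)) => le_ab.
  have := @nim_value_strip_ge k' l (a - s) (b - s); rewrite -Eq vq; lia.
have := @nim_value_strip_ge k' l (b - s) (a - s).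
by rewrite -nim_value_swap /= -Eq vq; lia.
Qed.
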